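(* Let $K$ be an algebraically closed field, let $w_\Sigma$ be a word with constants in $m$ variables with $\Sigma\subset\operatorname{SL}_n(K)$ (the case $\Sigma=\emptyset$ being allowed), and let $\tilde w_\Sigma\colon\operatorname{SL}_n(K)^m\to\operatorname{SL}_n(K)$ be the induced map. Then, for each $i=1,\dots,n$, the function $\chi_i\circ\tilde w_\Sigma\colon\operatorname{SL}_n(K)^m\to K$ is either a constant function or takes every value in $K$.
   Context: A word with constants over $G=\operatorname{SL}_n(K)$ is an expression $w_\Sigma=w_1\sigma_1w_2\sigma_2\cdots w_r\sigma_rw_{r+1}$, where $w_1,\dots,w_{r+1}$ are reduced words in the free group $F_m$ on $x_1,\dots,x_m$, $w_2,\dots,w_r\ne1$, and $\Sigma=\{\sigma_1,\dots,\sigma_r\}$ with $\sigma_i\in G\setminus Z(G)$; a word $w\in F_m$ is regarded as a word with constants with $\Sigma=\emptyset$. The map $\tilde w_\Sigma\colon G^m\to G$ is obtained by substituting elements of $G$ for the variables. For $X\in\operatorname{M}_n(K)$, $\chi_1(X),\dots,\chi_n(X)$ are the coefficients of the characteristic polynomial $\chi(X)=\lambda^n+\chi_1(X)\lambda^{n-1}+\cdots+\chi_n(X)$. *)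

(* Defs.v *)
From HB Require Import structures.
From mathcomp Require Import all_boot all_order all_algebra.

Set Implicit Arguments.
Unset Strict Implicit.
Unset Printing Implicit Defensive.

Import GRing.Theory.

Section SpecialLinear.

Local Open Scope ring_scope.

Variables (K : fieldType) (n : nat).

Record SL := MkSL { SL_mx :> 'M[K]_n; SL_det : \det SL_mx == 1 }.

HB.instance Definition _ := [isSub for SL_mx].
HB.instance Definition _ := [Choice of SL by <:].

Lemma SL_unitmx (A : SL) : SL_mx A \in unitmx.
Proof. by rewrite unitmxE (eqP (SL_det A)) unitr1. Qed.

Fact SL_one_det : \det (1%:M : 'M[K]_n) == 1.
Proof. by rewrite det1. Qed.

Fact SL_mul_det (A B : SL) : \det (SL_mx A *m SL_mx B) == 1.
Proof. by rewrite det_mulmx (eqP (SL_det A)) (eqP (SL_det B)) mulr1. Qed.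

Fact SL_inv_det (A : SL) : \det (invmx (SL_mx A)) == 1.
Proof. by rewrite det_inv (eqP (SL_det A)) invr1. Qed.

Definition SL_one := MkSL SL_one_det.
Definition SL_mul (A B : SL) := MkSL (SL_mul_det A B).
Definition SL_inv (A : SL) := MkSL (SL_inv_det A).

Fact SL_mulA : associative SL_mul.
Proof. by move=> A B C; apply: val_inj; rewrite /= mulmxA. Qed.

Fact SL_mul1 : left_id SL_one SL_mul.
Proof. by move=> A; apply: val_inj; rewrite /= mul1mx. Qed.

Fact SL_mulr1 : right_id SL_one SL_mul.
Proof. by move=> A; apply: val_inj; rewrite /= mulmx1. Qed.

Fact SL_mulV : left_inverse SL_one SL_inv SL_mul.
Proof. by move=> A; apply: val_inj; rewrite /= mulVmx // SL_unitmx. Qed.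

Fact SL_mulrV : right_inverse SL_one SL_inv SL_mul.
Proof. by move=> A; apply: val_inj; rewrite /= mulmxV // SL_unitmx. Qed.

HB.instance Definition _ :=
  isGroup.Build SL SL_mulA SL_mul1 SL_mulr1 SL_mulV SL_mulrV.

(* char_poly X is \det ('X - X), of degree n, so chi i X is the coefficient of
   lambda^(n - i); it is meant for 1 <= i <= n. *)
Definition chi (i : nat) (X : 'M[K]_n) : K := (char_poly X)`_(n - i).

End SpecialLinear.

Section Words.

Local Open Scope group_scope.

(* The letter (i, b) stands for x_i if b is false, and for x_i^-1 if b is
   true. *)
Definition letter (m : nat) : Type := ('I_m * bool)%type.

Definition reduced (m : nat) (w : seq (letter m)) : bool :=
  sorted (fun a b => ~~ ((a.1 == b.1) && (a.2 != b.2))) w.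

Definition eval_letter (G : groupType) (m : nat) (g : {ffun 'I_m -> G})
    (a : letter m) : G :=
  if a.2 then (g a.1)^-1 else g a.1.

Definition eval_word (G : groupType) (m : nat) (g : {ffun 'I_m -> G})
    (w : seq (letter m)) : G :=
  \prod_(a <- w) eval_letter g a.

Definition central (G : groupType) (s : G) : Prop := forall g : G, commute s g.

(* w_1 sigma_1 w_2 sigma_2 ... w_r sigma_r w_(r+1), with the words and the
   constants indexed from 0: wc_word i is w_(i+1) and wc_const i is
   sigma_(i+1). The case wc_len = 0 is that of an element of the free group. *)
Record word_const (G : groupType) (m : nat) := WordConst {
  wc_len : nat;
  wc_word : 'I_wc_len.+1 -> seq (letter m);
  wc_const : 'I_wc_len -> G;
  wc_reduced : forall i, reduced (wc_word i);
  wc_inner_neq1 : forall i : 'I_wc_len.+1, 0 < i < wc_len -> wc_word i != [::];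
  wc_noncentral : forall i, ~ central (wc_const i)
}.

Definition eval_wc (G : groupType) (m : nat) (w : word_const G m)
    (g : {ffun 'I_m -> G}) : G :=
  (\prod_(i < wc_len w)
     (eval_word g (wc_word (widen_ord (leqnSn _) i)) * wc_const i))
  * eval_word g (wc_word (@ord_max (wc_len w))).

End Words.

(* Main.v *)
Require Import Defs.
From Stdlib Require Import Classical.
From mathcomp Require Import all_boot all_order all_algebra.

Set Implicit Arguments.
Unset Strict Implicit.
Unset Printing Implicit Defensive.

Import GRing.Theory.
Local Open Scope ring_scope.

(** The group [SL_n(K)] is connected by polynomial curves: every [A] in it is
    [Q(1)] for some matrix [Q] over [K[t]] with determinant 1 and [Q(0) = 1].
    Indeed Gaussian elimination writes [A] as a product of unipotent
    block-triangular matrices, and the off-diagonal block of each factor can be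
    multiplied by [t] without changing its determinant
    ([SL_polynomially_connected]). Hence any two points [g], [g'] of [SL_n(K)^m]
    are the values at 0 and 1 of a single curve [t |-> (g_k Q_k(t))_k].

    Along such a curve the value of a word with constants is a matrix with
    entries in [K[t]]: products stay polynomial, and so do inverses, because in
    [SL_n] the inverse is the adjugate ([polynomial_curve_eval_wc]). So the
    restriction of [chi_i] of the word to the curve is a polynomial [p] in [t].

    If the function is not constant, take [g], [g'] where its values differ. Then
    [p(0) <> p(1)], so [p - c] is a nonconstant polynomial for every [c] and has
    a root in the algebraically closed field [K]: the value [c] is taken on the
    curve ([nonconstant_poly_surjective]). *)

(** * Polynomial curves of determinant one *)

Section PolynomialConnectedness.

Variable K : fieldType.

Definition eval_mx m n (t : K) (Q : 'M[{poly K}]_(m, n)) : 'M[K]_(m, n) :=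
  map_mx (horner_eval t) Q.

Lemma eval_mx1 n t : eval_mx t (1%:M : 'M_n) = 1%:M.
Proof. by rewrite /eval_mx map_mx1. Qed.

Lemma eval_mxM m n p t (P : 'M_(m, n)) (Q : 'M_(n, p)) :
  eval_mx t (P *m Q) = eval_mx t P *m eval_mx t Q.
Proof. by rewrite /eval_mx map_mxM. Qed.

Lemma eval_mxC m n t (A : 'M[K]_(m, n)) : eval_mx t (map_mx polyC A) = A.
Proof. by apply/matrixP=> i j; rewrite !mxE /horner_eval hornerC. Qed.

Lemma eval_mxXC m n t (A : 'M[K]_(m, n)) :
  eval_mx t ('X *: map_mx polyC A) = t *: A.
Proof.
by apply/matrixP=> i j; rewrite !mxE /horner_eval hornerM hornerX hornerC.
Qed.

Definition joined_to_1 n (A : 'M[K]_n) : Prop :=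
  exists Q : 'M[{poly K}]_n,
    [/\ \det Q = 1, eval_mx 0 Q = 1%:M & eval_mx 1 Q = A].

Lemma joined_to_1M n (A B : 'M[K]_n) :
  joined_to_1 A -> joined_to_1 B -> joined_to_1 (A *m B).
Proof.
move=> [P [dP P0 P1]] [Q [dQ Q0 Q1]]; exists (P *m Q).
by split; rewrite ?eval_mxM ?det_mulmx ?dP ?dQ ?mulr1 ?P0 ?Q0 ?mulmx1 ?P1 ?Q1.
Qed.

Lemma joined_to_1_tr n (A : 'M[K]_n) : joined_to_1 A -> joined_to_1 A^T.
Proof.
move=> [Q [dQ Q0 Q1]]; exists Q^T.
by split; rewrite ?det_tr // /eval_mx -map_trmx -/(eval_mx _ _) ?Q0 ?Q1 ?trmx1.
Qed.

Lemma joined_to_1_upper m n (B : 'M[K]_(m, n)) :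
  joined_to_1 (block_mx 1%:M B 0 1%:M).
Proof.
exists (block_mx 1%:M ('X *: map_mx polyC B) 0 1%:M); split.
- by rewrite det_ublock !det1 mulr1.
- by rewrite /eval_mx map_block_mx -!/(eval_mx _ _) eval_mxXC !eval_mx1 scale0r
    /eval_mx map_mx0 -scalar_mx_block.
- by rewrite /eval_mx map_block_mx -!/(eval_mx _ _) eval_mxXC !eval_mx1 scale1r
    /eval_mx map_mx0.
Qed.

Lemma joined_to_1_lower m n (C : 'M[K]_(n, m)) :
  joined_to_1 (block_mx 1%:M 0 C 1%:M).
Proof.
have := joined_to_1_tr (joined_to_1_upper C^T).
by rewrite tr_block_mx !trmx1 trmx0 trmxK.
Qed.

Lemma joined_to_1_block m n (D : 'M[K]_n) :
  joined_to_1 D -> joined_to_1 (block_mx (1%:M : 'M_m) 0 0 D).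
Proof.
move=> [Q [dQ Q0 Q1]]; exists (block_mx 1%:M 0 0 Q).
split; first by rewrite det_ublock det1 dQ mulr1.
- by rewrite /eval_mx map_block_mx -!/(eval_mx _ _) Q0 eval_mx1
    /eval_mx !map_mx0 -scalar_mx_block.
- by rewrite /eval_mx map_block_mx -!/(eval_mx _ _) Q1 eval_mx1
    /eval_mx !map_mx0.
Qed.

(** Gaussian elimination with a pivot equal to 1: the Schur complement is
    again of determinant one, and the other two factors are unipotent. *)
Lemma joined_to_1_pivot1 n (b : 'rV[K]_n) (c : 'cV[K]_n) (d : 'M[K]_n) :
  (forall D : 'M[K]_n, \det D = 1 -> joined_to_1 D) ->
  \det (block_mx (1%:M : 'M_1) b c d) = 1 -> joined_to_1 (block_mx 1%:M b c d).
Proof.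
move=> IH.
have -> : block_mx 1%:M b c d =
    block_mx 1%:M 0 c 1%:M *m block_mx 1%:M 0 0 (d - c *m b)
      *m block_mx (1%:M : 'M_1) b 0 1%:M.
  rewrite !mulmx_block !mul1mx !mul0mx !mulmx0 !mulmx1 !addr0 !add0r !mul1mx.
  by rewrite addrC subrK.
rewrite !det_mulmx det_lblock !det_ublock !det1 !mul1r !mulr1 => dD.
apply: joined_to_1M _ (joined_to_1_upper b).
apply: joined_to_1M (joined_to_1_lower c) _.
exact: joined_to_1_block (IH _ dD).
Qed.

(** A nonzero entry below the pivot allows a row operation that turns the
    pivot into 1. *)
Lemma joined_to_1_column n (a : 'M[K]_1) (b : 'rV[K]_n) (c : 'cV[K]_n)
    (d : 'M[K]_n) :
  (forall D : 'M[K]_n, \det D = 1 -> joined_to_1 D) ->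
  c != 0 -> \det (block_mx a b c d) = 1 -> joined_to_1 (block_mx a b c d).
Proof.
move=> IH /cV0Pn[i ci0] dA.
pose r : 'rV[K]_n := ((1 - a 0 0) / c i 0) *: delta_mx 0 i.
have rc : a + r *m c = 1%:M.
  rewrite -scalemxAl -rowE; apply/matrixP=> k l; rewrite !ord1 !mxE eqxx.
  by rewrite divfK // addrC subrK.
have -> : block_mx a b c d =
    block_mx 1%:M (- r) 0 1%:M *m block_mx 1%:M (b + r *m d) c d.
  rewrite mulmx_block !mul1mx !mul0mx !add0r !mulNmx -rc.
  by rewrite !addrK.
apply: joined_to_1M (joined_to_1_upper _) (joined_to_1_pivot1 IH _).
rewrite -[RHS]dA.
have -> : block_mx 1%:M (b + r *m d) c d =
    block_mx 1%:M r 0 1%:M *m block_mx a b c d.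
  by rewrite mulmx_block !mul1mx !mul0mx !add0r rc.
by rewrite det_mulmx det_ublock !det1 !mul1r.
Qed.

(** Induction on the size. If the first column is zero below the pivot, then the
    pivot is nonzero because the determinant is; it can be copied below itself,
    except in size one, where it equals 1 already. *)
Lemma SL_polynomially_connected n (A : 'M[K]_n) : \det A = 1 -> joined_to_1 A.
Proof.
elim: n A => [|n IH] A.
  move=> _; exists 1%:M; rewrite det1 !eval_mx1.
  by split=> //; rewrite [A]flatmx0 [1%:M]flatmx0.
rewrite -[A](@submxK _ 1 n 1 n).
move: (ulsubmx _) (ursubmx _) (dlsubmx _) (drsubmx _) => a b c d dA.
have [c0 | c_neq0] := eqVneq c 0; last exact: joined_to_1_column IH c_neq0 dA.
have det_ad : \det a * \det d = 1 by rewrite -(det_ublock a b) -c0.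
have [n0 | n_gt0] := posnP n.
  subst n; have a1 : a = 1%:M.
    move: det_ad; rewrite det_mx00 mulr1 {1}[a]mx11_scalar det_scalar1 => a00.
    by rewrite [a]mx11_scalar a00.
  by rewrite a1 in dA *; exact: joined_to_1_pivot1 dA.
have a_neq0 : a != 0.
  apply/eqP=> a0; move/eqP: det_ad.
  by rewrite a0 det0 mul0r eq_sym oner_eq0.
pose e : 'cV[K]_n := const_mx 1.
have -> : block_mx a b c d =
    block_mx 1%:M 0 (- e) 1%:M *m block_mx a b (c + e *m a) (d + e *m b).
  rewrite mulmx_block !mul1mx !mul0mx !addr0 !mulNmx.
  by rewrite ![- _ + _]addrC !addrK.
apply: joined_to_1M (joined_to_1_lower _) (joined_to_1_column IH _ _).
  rewrite c0 add0r; apply: contra a_neq0 => /eqP/matrixP/(_ (Ordinal n_gt0) 0).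
  rewrite !mxE big_ord1 !mxE mul1r => a00.
  by rewrite [a]mx11_scalar a00 raddf0.
rewrite -[RHS]dA.
have -> : block_mx a b (c + e *m a) (d + e *m b) =
    block_mx 1%:M 0 e 1%:M *m block_mx a b c d.
  by rewrite mulmx_block !mul1mx !mul0mx !addr0 [c + _]addrC [d + _]addrC.
by rewrite det_mulmx det_lblock !det1 !mul1r.
Qed.

End PolynomialConnectedness.

(** * Words with constants along polynomial curves *)

Section WordsAlongCurves.

Variables (K : fieldType) (n : nat).

Definition polynomial_curve (h : K -> SL K n) : Prop :=
  exists Q : 'M[{poly K}]_n, forall t, SL_mx (h t) = eval_mx t Q.

Lemma polynomial_curve_const (A : SL K n) : polynomial_curve (fun=> A).
Proof. by exists (map_mx polyC (SL_mx A)) => t; rewrite eval_mxC. Qed.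

Lemma polynomial_curveM (h k : K -> SL K n) :
  polynomial_curve h -> polynomial_curve k ->
  polynomial_curve (fun t => h t * k t)%g.
Proof.
by move=> [P hP] [Q kQ]; exists (P *m Q) => t; rewrite eval_mxM -hP -kQ.
Qed.

(** The inverse in [SL_n] is the adjugate, a polynomial in the entries. *)
Lemma polynomial_curveV (h : K -> SL K n) :
  polynomial_curve h -> polynomial_curve (fun t => (h t)^-1)%g.
Proof.
move=> [Q hQ]; exists (\adj Q) => t.
rewrite /eval_mx map_mx_adj -/(eval_mx t Q) -hQ /=.
by rewrite /invmx SL_unitmx (eqP (SL_det (h t))) invr1 scale1r.
Qed.

Lemma polynomial_curve_prod I (r : seq I) (F : K -> I -> SL K n) :
  (forall i, polynomial_curve (F^~ i)) ->
  polynomial_curve (fun t => \prod_(i <- r) F t i)%g.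
Proof.
move=> F_poly; elim: r => [|i r IHr].
  have [Q hQ] := polynomial_curve_const 1%g.
  by exists Q => t; rewrite big_nil -hQ.
have [Q hQ] := polynomial_curveM (F_poly i) IHr.
by exists Q => t; rewrite big_cons -hQ.
Qed.

Variables (m : nat) (g : K -> {ffun 'I_m -> SL K n}).
Hypothesis g_poly : forall k, polynomial_curve (fun t => g t k).

Lemma polynomial_curve_eval_word (s : seq (letter m)) :
  polynomial_curve (fun t => eval_word (g t) s).
Proof.
apply: polynomial_curve_prod => -[k []]; last exact: g_poly.
exact: polynomial_curveV.
Qed.

Lemma polynomial_curve_eval_wc (w : word_const (SL K n) m) :
  polynomial_curve (fun t => eval_wc w (g t)).
Proof.
apply: polynomial_curveM _ (polynomial_curve_eval_word _).
apply: polynomial_curve_prod => j.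
exact: polynomial_curveM (polynomial_curve_eval_word _)
  (polynomial_curve_const _).
Qed.

End WordsAlongCurves.

Lemma chi_polynomial_curve (K : fieldType) n (h : K -> SL K n) i :
  polynomial_curve h ->
  exists p : {poly K}, forall t, chi i (SL_mx (h t)) = p.[t].
Proof.
move=> [Q hQ]; exists (char_poly Q)`_(n - i) => t.
by rewrite /chi hQ /eval_mx -map_char_poly coef_map.
Qed.

Lemma SL_tuple_curve (K : fieldType) n m (g g' : {ffun 'I_m -> SL K n}) :
  exists h : K -> {ffun 'I_m -> SL K n},
    [/\ forall k, polynomial_curve (fun t => h t k), h 0 = g & h 1 = g'].
Proof.
have /fin_all_exists[Q hQ] k : joined_to_1 (SL_mx ((g k)^-1 * g' k)%g).
  exact: SL_polynomially_connected (eqP (SL_det _)).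
have det_Q t k : \det (eval_mx t (Q k)) == 1.
  by have [dQ _ _] := hQ k; rewrite /eval_mx det_map_mx dQ rmorph1.
exists (fun t => [ffun k => g k * MkSL (det_Q t k)]%g); split.
- move=> k.
  have [P hP] : polynomial_curve (fun t => g k * MkSL (det_Q t k))%g.
    by apply: polynomial_curveM (polynomial_curve_const _) _; exists (Q k).
  by exists P => t; rewrite ffunE.
- apply/ffunP=> k; rewrite ffunE; have [_ Q0 _] := hQ k.
  rewrite (_ : MkSL _ = 1%g) ?mulg1 //.
  by apply: val_inj; rewrite /= Q0.
- apply/ffunP=> k; rewrite ffunE; have [_ _ Q1] := hQ k.
  rewrite (_ : MkSL _ = (g k)^-1 * g' k)%g ?mulVKg //.
  by apply: val_inj; rewrite /= Q1.
Qed.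

Lemma nonconstant_poly_surjective (K : closedFieldType) (p : {poly K})
    (a b c : K) :
  p.[a] != p.[b] -> exists t, p.[t] = c.
Proof.
move=> pab; have /closed_rootP[t] : size (p - c%:P) != 1.
  apply: contra pab => /size_poly1P[d _ /(canRL (subrK _)) ->].
  by rewrite -polyCD !hornerC.
by rewrite /root hornerD hornerN hornerC subr_eq0 => /eqP <-; exists t.
Qed.

Theorem theorem2p4 (K : closedFieldType) (n m : nat)
    (w : word_const (SL K n) m) (i : nat) (hi : (1 <= i <= n)%N) :
  (exists c : K, forall g : {ffun 'I_m -> SL K n},
      chi i (SL_mx (eval_wc w g)) = c) \/
  (forall c : K, exists g : {ffun 'I_m -> SL K n},
      chi i (SL_mx (eval_wc w g)) = c).
Proof.
pose f g := chi i (SL_mx (eval_wc w g)).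
pose g0 : {ffun 'I_m -> SL K n} := [ffun=> 1%g].
have [[g fg] | f_const] := classic (exists g, f g0 != f g); last first.
  left; exists (f g0) => g; apply/esym/eqP; apply: contra_notT f_const => fg.
  by exists g.
right=> c; have [h [h_poly h0 h1]] := SL_tuple_curve g0 g.
have [p fp] := chi_polynomial_curve i (polynomial_curve_eval_wc h_poly w).
rewrite -h0 -h1 /f !fp in fg.
have [t <-] := nonconstant_poly_surjective c fg.
by exists (h t).
Qed.
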